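(* Let $n=2^k-1$ with $k\ge 2$ an integer and $\mathcal H=\bigotimes_{j=1}^n\mathbb C^2$. Let $S_1,\dots,S_r\subseteq[n]$ and let $D_1,\dots,D_r$ be subspaces of $\mathcal H$ with $\sum_{i=1}^r\dim D_i^\perp\le n$. Then there exists a nonzero product vector $\ket\psi=\ket{\psi_1}\otimes\cdots\otimes\ket{\psi_n}$ with $\ket\psi^{\Gamma(S_i)}\in D_i$ for all $i=1,\dots,r$.
   Context: For $S\subseteq[n]$, $\ket\psi^{\Gamma(S)}$ is obtained from $\ket\psi=\ket{\psi_1}\otimes\cdots\otimes\ket{\psi_n}$ by replacing $\ket{\psi_j}$ with its complex conjugate for each $j\in S$. $D^\perp$ is the orthogonal complement; $\sum_i\dim D_i^\perp$ is the number of (linear) equations of the system. *)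

(* Defs.v *)
(* complex numbers R[i] over a real type R (= C when R = reals). *)
From HB Require Import structures.
From mathcomp Require Import all_boot all_order all_algebra.
From mathcomp Require Import complex.
From mathcomp Require Import reals.
Set Implicit Arguments. Unset Strict Implicit. Unset Printing Implicit Defensive.
Import Order.TTheory GRing.Theory Num.Theory.
Local Open Scope ring_scope.

Section QubitDefs.
Variable R : realType.
Local Notation C := (R[i]).

(* The n-qubit Hilbert space (C^2)^{\otimes n}, realized as functions on the
   computational basis {0,1}^n, i.e. on {ffun 'I_n -> 'I_2}. *)
Definition qspace (n : nat) := {ffun {ffun 'I_n -> 'I_2} -> C^o}.

(* Standard Hermitian inner product <v,w> = sum_x v(x) * conj(w(x))
   (linear in the first argument). *)
Definition qdot (n : nat) (v w : qspace n) : C :=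
  \sum_x v x * (w x)^*.

(* Orthogonal complement of a subspace D of the n-qubit space:
   the kernel of v |-> (<v, b_i>)_i where (b_i) is a basis of D. *)
Definition qperp (n : nat) (D : {vspace qspace n}) : {vspace qspace n} :=
  lker (linfun (fun v : qspace n =>
          \row_(i < \dim D) qdot v (tnth (vbasis D) i) : 'rV[C^o]_(\dim D))).

(* Product vector |psi_1> (x) ... (x) |psi_n>, psi j : C^2 as row vectors. *)
Definition prodvec (n : nat) (psi : 'I_n -> 'rV[C]_2) : qspace n :=
  [ffun x : {ffun 'I_n -> 'I_2} => \prod_(j < n) psi j 0 (x j)].

(* Partial conjugation |psi>^{Gamma(S)}: conjugate the factors j in S. *)
Definition partial_conj (n : nat) (S : {set 'I_n}) (psi : 'I_n -> 'rV[C]_2)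
  : 'I_n -> 'rV[C]_2 :=
  fun j => if j \in S then map_mx (fun z : C => z^*) (psi j) else psi j.

End QubitDefs.

(* Main.v *)
Require Import Defs.
From HB Require Import structures.
From mathcomp Require Import all_boot all_order all_fingroup all_algebra.
From mathcomp Require Import zify ring lra.
From mathcomp Require Import complex.
From mathcomp Require Import boolp classical_sets reals topology normedtype derive trigo.
Set Implicit Arguments. Unset Strict Implicit. Unset Printing Implicit Defensive.
Import Order.TTheory GRing.Theory Num.Theory.
Import numFieldNormedType.Exports.
Local Open Scope ring_scope.

(** Each linear equation on psi^Gamma(S_i) is a section of a line bundle L_i on
(P^1)^n, of degree -1 or 1 on the j-th factor according to whether j is in S_i or
not. If n such sections had no common zero, the product of the Chern classes of
the L_i would vanish; but this product is the permanent of the sign matrix, which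
is nonzero because n = 2^k - 1 (its 2-adic valuation is that of n!).

The topological step is carried out on a grid. Pull everything back along a degree
one map from the 2-torus to P^1, so that the base becomes (Z/N)^(2n) with its
staircase triangulation. Rounding the variation of the phase of the i-th section
along edges gives an integer 1-cochain, and correcting the standard cocycle of
L_i by its coboundary yields a cohomologous cocycle that is zero on each simplex
where the phase varies slowly. As the cup product has a nonzero integral, some
simplex has no slow section: there all sections have size O(1/N), and a
cluster point of these simplices is a common zero. *)

(** * Permanents of sign matrices *)

Section Permanent.
Local Open Scope nat_scope.

(** The terms after the first form the same sum for [b %/ 2], so by induction the total is less than
    twice [b %/ 2] when this is positive. *)
Lemma sum_divn_pow2_lt m b : 0 < b -> \sum_(1 <= j < m.+1) b %/ 2 ^ j < b.
Proof.
elim: m b => [|m IH] b b0; first by rewrite big_nil.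
rewrite big_ltn // expn1 big_add1 /=.
have -> : \sum_(1 <= i < m.+1) b %/ 2 ^ i.+1 = \sum_(1 <= i < m.+1) (b %/ 2) %/ 2 ^ i.
  by apply: eq_bigr => i _; rewrite expnS divnMA.
have [b2|] := posnP (b %/ 2); last by move/IH; lia.
by rewrite b2 big1 // => i _; rewrite div0n.
Qed.

Lemma logn2_fact_lt b : 0 < b -> logn 2 b`! < b.
Proof. by move=> b0; rewrite logn_fact // sum_divn_pow2_lt. Qed.

(** The power of 2 in [c] is below [2 ^ k], hence divides [2 ^ k - c] too; the reverse inequality
    follows by applying this to [2 ^ k - c]. *)
Lemma logn2_pow2_sub k c : 0 < c < 2 ^ k -> logn 2 (2 ^ k - c) = logn 2 c.
Proof.
have le x : 0 < x < 2 ^ k -> logn 2 x <= logn 2 (2 ^ k - x).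
  move=> /andP[x0 xk]; rewrite -pfactor_dvdn ?subn_gt0 //.
  apply: dvdn_sub; last exact: pfactor_dvdnn.
  rewrite dvdn_exp2l // ltnW // -(@ltn_exp2l 2) //.
  by apply: leq_ltn_trans xk; apply: dvdn_leq => //; exact: pfactor_dvdnn.
move=> ck; apply/eqP; rewrite eqn_leq le // andbT.
have := le (2 ^ k - c); rewrite subKn; last by lia.
by apply; lia.
Qed.

(** The falling factorial has the factors [2 ^ k - c] for c from 1 to [b], whose valuations are
    those of the factors c of the factorial. *)
Lemma logn2_ffact k b : b <= (2 ^ k).-1 -> logn 2 ((2 ^ k).-1 ^_ b) = logn 2 b`!.
Proof.
elim: b => // b IH hb.
rewrite ffactnSr factS !lognM ?fact_gt0 ?ffact_gt0 ?subn_gt0 //; last exact: ltnW.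
rewrite IH; last exact: ltnW.
rewrite addnC -(@logn2_pow2_sub k b.+1); last by lia.
by congr (logn _ _ + _); lia.
Qed.

(** [g] is constant on the right cosets of the pointwise stabilizer of [B], which is the symmetric
    group on the complement. *)
Lemma dvdn_sum_perm_agree (T : finType) (B : {set T}) (g : {perm T} -> nat) :
    (forall s s' : {perm T}, {in B, s =1 s'} -> g s = g s') ->
  (#|~: B|)`! %| \sum_s g s.
Proof.
move=> gB; pose H : {group {perm T}} := Sym_group (~: B).
have cH : #|H| = (#|~: B|)`! by rewrite -card_perm; apply: eq_card => s; rewrite !inE.
have Hfix h : h \in H -> {in B, forall i, h i = i}.
  rewrite inE => Hh i Bi; apply: (out_perm Hh).
  by rewrite inE negbK.
rewrite (partition_big (fun s => (H :* s)%g) predT) //=.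
apply: dvdn_sum => C _.
case: (pickP (fun s : {perm T} => (H :* s)%g == C)) => [r /eqP hr|h]; last first.
  by rewrite big_pred0 ?dvdn0.
rewrite (eq_bigr (fun _ => g r)) => [|s /eqP hs].
  rewrite (eq_bigl (mem (H :* r)%g)) => [|s].
    by rewrite sum_nat_const card_rcoset cH dvdn_mulr.
  by rewrite -hr; apply/eqP/idP => h; apply/rcoset_eqP.
have : s \in (H :* r)%g by rewrite hr -hs rcoset_refl.
case/rcosetP => h hH ->; apply: gB => i Bi.
by rewrite permM (Hfix h).
Qed.

(** Each sign is 1 or 1 - 2; expanding the product over sets [B] of rows gives n! for the empty set.
    For b = |B| > 0 the term is divisible by 2^b (n - b)!, whose valuation exceeds v(n!) = v(b!) +
    v((n - b)!), because v(b!) < b. *)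
Lemma permanent_sign_neq0 k (a : 'I_(2 ^ k).-1 -> 'I_(2 ^ k).-1 -> bool) :
  (\sum_(s : 'S_(2 ^ k).-1) \prod_i (-1) ^+ (a i (s i)) != 0 :> int)%R.
Proof.
set n := (2 ^ k).-1; pose e := logn 2 n`!.
pose t (B : {set 'I_n}) : int :=
  (\sum_(s : 'S_n) \prod_i (if i \in B then (- 2) * (a i (s i))%:Z else 1))%R.
have -> : (\sum_(s : 'S_n) \prod_i (-1) ^+ (a i (s i)) = \sum_(B : {set 'I_n}) t B :> int)%R.
  rewrite /t exchange_big; apply: eq_bigr => s _ /=.
  rewrite -bigA_distr; apply: eq_bigr => i _.
  by case: (a i (s i)).
have tB B : B != finset.set0 -> (2 ^ e.+1 %| `|t B|)%N.
  move=> B0; have b0 : 0 < #|B| by rewrite card_gt0.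
  have bn : #|B| <= n by rewrite -[n in _ <= n]card_ord max_card.
  have -> : t B = ((- 2) ^+ #|B| * (\sum_(s : 'S_n) \prod_(i in B) (a i (s i) : nat))%:R)%R.
    rewrite /t natr_sum mulr_sumr; apply: eq_bigr => s _.
    rewrite natr_prod -big_mkcond /= big_split /= prodr_const.
    by congr (_ * _)%R; apply: eq_bigr => i _; rewrite natz.
  rewrite abszM abszX [((\sum_s _)%:R)%R]natz absz_nat.
  apply: (@dvdn_trans (2 ^ #|B| * (n - #|B|)`!)); last first.
    apply: dvdn_mul => //.
    have -> : n - #|B| = #|~: B| by have := cardsC B; rewrite card_ord; lia.
    apply: dvdn_sum_perm_agree => s s' ss; by apply: eq_bigr => i Bi; rewrite ss.
  rewrite pfactor_dvdn ?muln_gt0 ?expn_gt0 ?fact_gt0 // lognM ?expn_gt0 ?fact_gt0 //.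
  rewrite pfactorK // /e -(ffact_fact bn) lognM ?ffact_gt0 ?fact_gt0 //.
  by rewrite logn2_ffact // -addSn leq_add2r logn2_fact_lt.
have t0 : t finset.set0 = (n`!)%:Z.
  rewrite /t (eq_bigr (fun _ => 1%R)) => [|s _].
    by rewrite sumr_const cardT -cardE card_Sn natz.
  by rewrite big1 // => i _; rewrite inE.
apply/eqP; rewrite (bigD1 finset.set0) //= => /eqP; rewrite addr_eq0 t0 => /eqP E.
have : (2 ^ e.+1 %| n`!)%N.
  have : ((2 ^ e.+1)%:Z %| - \sum_(B | B != finset.set0) t B)%Z.
    by rewrite rpredN; apply: rpred_sum => B hB; exact: tB.
  by rewrite -E.
by rewrite pfactor_dvdn ?fact_gt0 // ltnn.
Qed.

End Permanent.

(** * Cochains on a triangulated torus *)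

Section Cochains.
Variable V : Type.
Implicit Types (w : nat -> V) (f g : (nat -> V) -> int).

Definition shift p w : nat -> V := fun q => w (p + q)%N.

(** A p-cochain is a function of an infinite vertex sequence that reads only the entries 0 to p;
    thus cochains of all degrees share one type. *)
Definition local_upto p f :=
  forall w w', (forall q, (q <= p)%N -> w q = w' q) -> f w = f w'.

Definition cup p f g w : int := f w * g (shift p w).

Definition codiff p f w : int := \sum_(r < p.+2) (-1) ^+ r * f (w \o bump r).

Lemma local_cup p q f g :
  local_upto p f -> local_upto q g -> local_upto (p + q) (cup p f g).
Proof.
move=> lf lg w w' e; congr (_ * _).
  by apply: lf => r hr; apply: e; lia.
by apply: lg => r hr; apply: e; lia.
Qed.

(** Leibniz rule. Deleting one of the first p + 1 vertices affects only [f] and the front face,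
    deleting a later one only [g]. On the right, the last face of [f] and the first face of [g]
    contribute opposite terms. *)
Lemma codiff_cup p q f g w : local_upto p f -> local_upto q g ->
  codiff (p + q) (cup p f g) w =
  codiff p f w * g (shift p.+1 w) + (-1) ^+ p * (f w * codiff q g (shift p w)).
Proof.
move=> lf lg; rewrite /codiff /cup.
have -> : (p + q).+2 = (p.+1 + q.+1)%N by lia.
rewrite big_split_ord /= (big_ord_recr p.+1) /= (big_ord_recl q.+1) /=.
have -> : \sum_(i < p.+1) (-1) ^+ i *
     (f (w \o bump i) * g (shift p (w \o bump i))) =
   (\sum_(i < p.+1) (-1) ^+ i * f (w \o bump i)) * g (shift p.+1 w).
  rewrite mulr_suml; apply: eq_bigr => i _; rewrite mulrA; congr (_ * _).
  by apply: lg => r _ /=; rewrite /shift /=; congr w; rewrite /bump; case: i => i /=; lia.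
have -> : \sum_(i < q.+1) (-1) ^+ (p.+1 + i) *
     (f (w \o bump (p.+1 + i)) * g (shift p (w \o bump (p.+1 + i)))) =
   (-1) ^+ p * (f w * \sum_(i < q.+1) (-1) ^+ bump 0 i * g (shift p w \o bump (bump 0 i))).
  rewrite !mulr_sumr; apply: eq_bigr => i _.
  have -> : f (w \o bump (p.+1 + i)) = f w.
    by apply: lf => r hr /=; congr w; rewrite /bump; lia.
  have -> : g (shift p (w \o bump (p.+1 + i))) = g (shift p w \o bump (bump 0 i)).
    by apply: lg => r hr /=; rewrite /shift /=; congr w; rewrite /bump; lia.
  by rewrite /bump /= addSn add1n !exprS !exprD; ring.
have -> : f (w \o bump p.+1) = f w.
  by apply: lf => r hr /=; congr w; rewrite /bump; lia.
have -> : g (shift p w \o bump 0) = g (shift p.+1 w).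
  by apply: lg => r hr /=; rewrite /shift /=; congr w; rewrite /bump; lia.
rewrite /= expr0 exprS.
ring.
Qed.

End Cochains.

(** * The staircase triangulation and Stokes' formula *)

Section Torus.
Variables (A : finZmodType) (e : A) (m : nat).
Local Notation V := {ffun 'I_m.+1 -> A}.

(** Top simplex of the cube at [v]: [s k] is the rank at which coordinate [k] takes its step [e]. *)
Definition stair (v : V) (s : 'S_m.+1) (q : nat) : V :=
  [ffun k => v k + e *+ (s k < q)%N].

(** Evaluation on the fundamental class of the torus, of dimension m + 1. *)
Definition integral (f : (nat -> V) -> int) : int :=
  \sum_v \sum_(s : 'S_m.+1) (-1) ^+ s * f (stair v s).

(** Every face of codimension one is shared by two top simplices, with opposite signs. *)
Lemma integral_codiff f : local_upto m f -> integral (codiff m f) = 0.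
Proof.
move=> lf; rewrite /integral /codiff.
have -> : \sum_v \sum_(s : 'S_m.+1) (-1) ^+ s *
      (\sum_(r < m.+2) (-1) ^+ r * f (stair v s \o bump r)) =
  \sum_(r < m.+2) (-1) ^+ r *
     \sum_v \sum_(s : 'S_m.+1) (-1) ^+ s * f (stair v s \o bump r).
  rewrite [RHS](eq_bigr (fun r : 'I_m.+2 => \sum_v \sum_(s : 'S_m.+1)
     (-1) ^+ s * ((-1) ^+ r * f (stair v s \o bump r)))); last first.
    move=> r _; rewrite mulr_sumr; apply: eq_bigr => v _.
    by rewrite mulr_sumr; apply: eq_bigr => s _; rewrite mulrCA.
  rewrite [RHS]exchange_big; apply: eq_bigr => v _ /=.
  by rewrite [RHS]exchange_big; apply: eq_bigr => s _ /=; rewrite mulr_sumr.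
(* Inner faces: exchanging the ranks r and r + 1 changes only the vertex r + 1, which is the one
   deleted, and reverses the sign. *)
rewrite big_ord_recr big_ord_recl /= [X in _ + X + _]big1 ?addr0 => [|r _]; last first.
  rewrite [X in _ * X](_ : _ = 0) ?mulr0 //.
  rewrite exchange_big /=.
  pose t : 'S_m.+1 := tperm (inord r) (inord r.+1).
  have rv : @inord m r = r :> nat by rewrite inordK //; case: (r) => /= ? ?; lia.
  have rv' : @inord m r.+1 = r.+1 :> nat by rewrite inordK //; case: (r) => /= ? ?; lia.
  pose G (s : 'S_m.+1) := \sum_v (-1) ^+ s * f (stair v s \o bump (bump 0 r)).
  suff H s : G (s * t)%g = - G s.
    have E : \sum_s G s = - \sum_s G s.
      by rewrite {1}(reindex_inj (mulIg t)) /= -sumrN; apply: eq_bigr => s _; rewrite H.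
    have opp_eq0 (x : int) : x = - x -> x = 0 by lia.
    exact: opp_eq0 E.
  rewrite /G -sumrN; apply: eq_bigr => v _.
  have -> : f (stair v (s * t)%g \o bump (bump 0 r)) = f (stair v s \o bump (bump 0 r)).
    apply: lf => q _; apply/ffunP => k /=; rewrite !ffunE permM.
    congr (_ + _ *+ nat_of_bool _).
    have b : bump (bump 0 r) q <> r.+1 by rewrite /bump; lia.
    by rewrite /t; case: tpermP => [->|->|//]; rewrite ?rv ?rv'; apply/idP/idP; lia.
  have nt : (inord r : 'I_m.+1) != inord r.+1.
    by apply/eqP => /(congr1 val) /=; rewrite rv rv'; lia.
  by rewrite odd_permM odd_tperm nt addbT; case: (odd_perm s);
    rewrite /= !(expr0, expr1) ?mulN1r ?mul1r ?opprK.
(* Outer faces: without its first vertex, a simplex is another one without its last vertex. The base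
   point moves by [d], the step of rank 0, and [t] rotates the ranks cyclically, with sign
   (-1)^m. *)
pose t : 'S_m.+1 := lift_perm ord0 ord_max 1%g.
have -> : \sum_v \sum_(s : 'S_m.+1) (-1) ^+ s * f (stair v s \o bump 0) =
     (-1) ^+ m * \sum_v \sum_(s : 'S_m.+1) (-1) ^+ s * f (stair v s \o bump m.+1).
  rewrite exchange_big /= [X in _ = _ * X]exchange_big /=.
  rewrite [X in _ = _ * X](reindex_inj (mulIg t)) /= mulr_sumr.
  apply: eq_bigr => s _.
  pose d : V := [ffun k => e *+ (s k == ord0)].
  rewrite mulr_sumr [RHS](reindex_inj (addIr d)) /=; apply: eq_bigr => v _.
  rewrite mulrA; congr (_ * _).
    rewrite odd_permM odd_lift_perm odd_perm1 /= addbF.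
    by rewrite -[in X in _ = X * _]signr_odd; case: (odd m); case: (odd_perm s).
  apply: lf => q hq; apply/ffunP => k /=; rewrite !ffunE permM -addrA; congr (_ + _).
  case: (unliftP ord0 (s k)) => [j ->|->].
    rewrite lift_perm_lift perm1 eq_sym (negbTE (neq_lift _ _)) /= add0r.
    by congr (_ *+ nat_of_bool _); rewrite /bump /=; case: j => j /= hj; apply/idP/idP; lia.
  rewrite lift_perm_id eqxx /=.
  have -> : (m < bump m.+1 q)%N = false by rewrite /bump; apply/idP; lia.
  by rewrite addr0.
by rewrite mul1r exprS mulN1r mulNr addrN.
Qed.

End Torus.

(** * Products of cocycles of degree 2 *)

Section ClosedCochains.
Variables (V : Type) (P : (nat -> V) -> Prop).
Hypothesis P_shift : forall p w, P w -> P (shift p w).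
Implicit Types (w : nat -> V) (f g : (nat -> V) -> int).

(** Closedness is relative to [P] because the cochains used below are closed only on sequences of
    vertices of a common cell. *)
Definition closed_on p f := forall w, P w -> codiff p f w = 0.

Lemma closed_cup p q f g : local_upto p f -> local_upto q g ->
  closed_on p f -> closed_on q g -> closed_on (p + q) (cup p f g).
Proof.
move=> lf lg cf cg w Pw; rewrite codiff_cup // cf // cg; last exact: P_shift.
by rewrite mul0r !mulr0 addr0.
Qed.

Definition cupn n (c : nat -> (nat -> V) -> int) w : int :=
  \prod_(i < n) c i (shift i.*2 w).

Lemma cupnD t r c w : (forall i, local_upto 2 (c i)) ->
  cupn (t + r) c w = cup t.*2 (cupn t c) (cupn r (fun i => c (t + i)%N)) w.
Proof.
move=> lc; rewrite /cupn /cup big_split_ord /=; congr (_ * _).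
apply: eq_bigr => i _; apply: lc => q _; rewrite /shift.
by congr w; rewrite doubleD addnA.
Qed.

Lemma local_cupn n c : (forall i, local_upto 2 (c i)) -> local_upto n.*2 (cupn n c).
Proof.
move=> lc w w' e; apply: eq_bigr => i _; apply: lc => q hq; apply: e.
by case: i => i /= hi; lia.
Qed.

Lemma closed_cupn n c : (forall i, local_upto 2 (c i)) ->
  (forall i, closed_on 2 (c i)) -> closed_on n.*2 (cupn n c).
Proof.
elim: n c => [|n IH] c lc cc w Pw.
  by rewrite /codiff !big_ord_recl big_ord0 /cupn !big_ord0.
have -> : codiff n.+1.*2 (cupn n.+1 c) w =
    codiff (2 + n.*2) (cup 2 (c 0%N) (cupn n (fun i => c i.+1))) w.
  rewrite /codiff -[n.+1.*2.+2]/(2 + n.*2).+2; apply: eq_bigr => r _.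
  rewrite -[n.+1]/(1 + n)%N (@cupnD 1 n) // /cup {1}/cupn big_ord_recl big_ord0 mulr1.
  by congr (_ * (_ * _)).
apply: closed_cup => //; first exact: local_cupn.
by apply: IH => i.
Qed.

(** By the Leibniz rule only the coboundary of [a] survives, the other factors being closed; no sign
    appears since [t.*2] is even. *)
Lemma cupn_exact t r c c' a w :
    (forall i, local_upto 2 (c i)) -> (forall i, local_upto 2 (c' i)) ->
    local_upto 1 a ->
    (forall i, closed_on 2 (c i)) -> (forall i, closed_on 2 (c' i)) -> P w ->
  codiff (t.*2 + (1 + r.*2)) (cup t.*2 (cupn t c') (cup 1 a (cupn r c))) w =
  cupn t c' w * (codiff 1 a (shift t.*2 w) * cupn r c (shift t.+1.*2 w)).
Proof.
move=> lc lc' la cc cc' Pw.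
have lr := @local_cupn r c lc; have lt := @local_cupn t c' lc'.
rewrite codiff_cup //; last exact: local_cup.
rewrite closed_cupn // mul0r add0r codiff_cup //.
rewrite (@closed_cupn r c) //; last by do 2!apply: P_shift.
rewrite !mulr0 addr0 -signr_odd odd_double expr0 mul1r; congr (_ * (_ * _)).
by apply: lr => q _; rewrite /shift; congr w; lia.
Qed.

End ClosedCochains.

Lemma integral_eq (A : finZmodType) (e : A) m (f g : (nat -> {ffun 'I_m.+1 -> A}) -> int) :
  (forall v s, f (stair e v s) = g (stair e v s)) -> integral e f = integral e g.
Proof. by move=> fg; apply: eq_bigr => v _; apply: eq_bigr => s _; rewrite fg. Qed.

Lemma integralD (A : finZmodType) (e : A) m (f g : (nat -> {ffun 'I_m.+1 -> A}) -> int) :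
  integral e (fun w => f w + g w) = integral e f + integral e g.
Proof.
rewrite /integral -big_split; apply: eq_bigr => v _ /=.
by rewrite -big_split; apply: eq_bigr => s _ /=; rewrite mulrDr.
Qed.

(** * Exchange of cohomologous cocycles *)

Section Replace.
Variables (A : finZmodType) (e : A) (m : nat).
Local Notation V := {ffun 'I_m.+1 -> A}.
Variable P : (nat -> V) -> Prop.
Hypothesis P_shift : forall p w, P w -> P (shift p w).
Hypothesis P_stair : forall v s, P (stair e v s).

(* Cohomologous cocycles have products with the same integral: they are
   exchanged one at a time, each exchange costing an exact cochain. *)
Lemma integral_cupn_cohomologous n (c c' a : nat -> (nat -> V) -> int) :
    n.*2 = m.+1 ->
    (forall i, local_upto 2 (c i)) -> (forall i, local_upto 2 (c' i)) ->
    (forall i, local_upto 1 (a i)) ->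
    (forall i, closed_on P 2 (c i)) -> (forall i, closed_on P 2 (c' i)) ->
    (forall i w, P w -> c' i w = c i w + codiff 1 (a i) w) ->
  integral e (cupn n c) = integral e (cupn n c').
Proof.
move=> nm lc lc' la cc cc' ca.
(* Hybrid family: the first [t] cocycles have been exchanged. *)
pose h t i := if (i < t)%N then c' i else c i.
have lh t i : local_upto 2 (h t i) by rewrite /h; case: ifP.
suff H t : (t <= n)%N -> integral e (cupn n (h 0%N)) = integral e (cupn n (h t)).
  transitivity (integral e (cupn n (h 0%N))) => //.
  rewrite (H n) //; apply: integral_eq => v s; apply: eq_bigr => i _.
  by rewrite /h ltn_ord.
elim: t => // t IH tn; rewrite IH; last exact: ltnW.
have [r er] : exists r, n = (t + r.+1)%N by exists (n - t.+1)%N; lia.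
pose cr i := c (t.+1 + i)%N.
have em : m = (t.*2 + (1 + r.*2))%N by lia.
have E t' v s : (t' <= t.+1)%N -> (t <= t')%N -> cupn n (h t') (stair e v s) =
   cupn t c' (stair e v s) *
     (h t' t (shift t.*2 (stair e v s)) * cupn r cr (shift t.+1.*2 (stair e v s))).
  move=> t1 t2; rewrite er cupnD // /cup; congr (_ * _).
    by apply: eq_bigr => i _; rewrite /h (leq_trans (ltn_ord i)).
  rewrite -[r.+1]/(1 + r)%N cupnD // /cup; congr (_ * _).
    by rewrite /cupn big_ord_recl big_ord0 mulr1 addn0; apply: lh => q _.
  apply: eq_big => // i _; rewrite /h /cr addnCA add1n addSn.
  rewrite ltnNge (leq_trans t1) ?leq_addr //=.
  by apply: lc => q _; rewrite /shift; congr stair; lia.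
have -> : integral e (cupn n (h t.+1)) = integral e (fun w => cupn n (h t) w +
    codiff m (cup t.*2 (cupn t c') (cup 1 (a t) (cupn r cr))) w).
  apply: integral_eq => v s; rewrite E // E //.
  have -> (f : (nat -> V) -> int) w : codiff m f w = codiff (t.*2 + (1 + r.*2)) f w by rewrite -em.
  have lcr i : local_upto 2 (cr i) by exact: lc.
  have ccr i : closed_on P 2 (cr i) by exact: cc.
  rewrite (@cupn_exact _ P) //.
  rewrite /h ltnn ltnSn ca; last exact: P_shift.
  by rewrite mulrDl mulrDr.
rewrite integralD integral_codiff ?addr0 //.
suff: local_upto (t.*2 + (1 + r.*2)) (cup t.*2 (cupn t c') (cup 1 (a t) (cupn r cr))).
  by rewrite -em.
apply: local_cup; first exact: local_cupn.
apply: local_cup => //; apply: local_cupn => i; exact: lc.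
Qed.

End Replace.

(** * Permutations of pairs of coordinates *)

Section BlockPermutation.
Variable n : nat.
Local Notation n1 := n.+1.
Local Notation M := n.*2.+2.

Definition evc (j : 'I_n1) : 'I_M := inord j.*2.
Definition odc (j : 'I_n1) : 'I_M := inord j.*2.+1.

Lemma evcE j : evc j = j.*2 :> nat.
Proof. by rewrite inordK //; case: j => j /=; lia. Qed.

Lemma odcE j : odc j = j.*2.+1 :> nat.
Proof. by rewrite inordK //; case: j => j /=; lia. Qed.

Variant coord_spec : 'I_M -> Type :=
  | CoordEven j : coord_spec (evc j)
  | CoordOdd j : coord_spec (odc j).

Lemma coordP k : coord_spec k.
Proof.
have hk : (k./2 < n1)%N by case: k => k /=; lia.
pose j := Ordinal hk.
case: (boolP (odd k)) => ok.
  have -> : k = odc j by apply: val_inj => /=; rewrite odcE /=; lia.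
  by constructor.
have -> : k = evc j by apply: val_inj => /=; rewrite evcE /=; lia.
by constructor.
Qed.

Definition blk (k : 'I_M) : 'I_n1 := inord k./2.

Lemma blk_ev j : blk (evc j) = j.
Proof. by apply: val_inj; rewrite /blk evcE doubleK inord_val. Qed.

Lemma blk_od j : blk (odc j) = j.
Proof. by apply: val_inj; rewrite /blk odcE /= uphalf_double inord_val. Qed.

Lemma odd_ev j : odd (evc j) = false.
Proof. by rewrite evcE odd_double. Qed.

Lemma odd_od j : odd (odc j).
Proof. by rewrite odcE /= odd_double. Qed.

Definition swap_fun (k : 'I_M) : 'I_M := if odd k then evc (blk k) else odc (blk k).

Lemma swap_ev j : swap_fun (evc j) = odc j.
Proof. by rewrite /swap_fun odd_ev blk_ev. Qed.

Lemma swap_od j : swap_fun (odc j) = evc j.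
Proof. by rewrite /swap_fun odd_od blk_od. Qed.

Lemma swap_inj : injective swap_fun.
Proof.
apply: (can_inj (g := swap_fun)) => k.
by case: (coordP k) => j; rewrite !(swap_ev, swap_od).
Qed.

Definition even_fun (s : 'S_n1) (k : 'I_M) : 'I_M :=
  if odd k then k else evc (s (blk k)).

Lemma even_ev s j : even_fun s (evc j) = evc (s j).
Proof. by rewrite /even_fun odd_ev blk_ev. Qed.

Lemma even_od s j : even_fun s (odc j) = odc j.
Proof. by rewrite /even_fun odd_od. Qed.

Lemma even_inj s : injective (even_fun s).
Proof.
apply: (can_inj (g := even_fun s^-1)) => k.
by case: (coordP k) => j; rewrite !(even_ev, even_od) // permK.
Qed.

(** The action on even coordinates times its conjugate on odd ones; the two factors have equal
    parity, so the product is even. *)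
Definition block_perm (s : 'S_n1) : 'S_M :=
  (perm (@even_inj s) * perm (@even_inj s) ^ perm swap_inj)%g.

Lemma odd_block_perm s : odd_perm (block_perm s) = false.
Proof. by rewrite odd_permM odd_permJ addbb. Qed.

Lemma swapV_ev j : ((perm swap_inj)^-1)%g (evc j) = odc j.
Proof. by apply: (canLR (permK _)); rewrite permE swap_od. Qed.

Lemma swapV_od j : ((perm swap_inj)^-1)%g (odc j) = evc j.
Proof. by apply: (canLR (permK _)); rewrite permE swap_ev. Qed.

Lemma block_perm_ev s j : block_perm s (evc j) = evc (s j).
Proof.
rewrite /block_perm /conjg !permM !(permE (@even_inj s)).
by rewrite even_ev swapV_ev even_od (permE swap_inj) swap_od.
Qed.

Lemma block_perm_od s j : block_perm s (odc j) = odc (s j).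
Proof.
rewrite /block_perm /conjg !permM !(permE (@even_inj s)).
by rewrite even_od swapV_od even_ev (permE swap_inj) swap_ev.
Qed.

End BlockPermutation.

(** * The standard cocycles of the torus *)

Section Wrap.
Variables (N n : nat).
Local Notation n1 := n.+1.
Local Notation m := n.*2.+1.
Local Notation A := 'I_N.+3.
Local Notation V := {ffun 'I_m.+1 -> A}.

(** Each coordinate steps at most once along the sequence. A modulus of at least 3 matters here:
    modulo 2 a coordinate could step twice and return. *)
Definition small (w : nat -> V) :=
  forall p q k, (p <= q)%N -> w q k = w p k \/ w q k = w p k + 1.

Lemma small_shift p w : small w -> small (shift p w).
Proof. by move=> sw q r k qr; apply: sw; rewrite leq_add2l. Qed.

Lemma small_stair v s : small (stair (1 : A) v s).
Proof.
move=> p q k pq; rewrite !ffunE.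
have [h|h] := ltnP (s k) p; first by rewrite (leq_trans h pq); left.
by case: ltnP => _; rewrite /= ?addr0; [right|left].
Qed.

Lemma ord_succ (x : A) : (x + 1 = 0 /\ x = N.+2 :> nat) \/ (x + 1)%R = x.+1 :> nat.
Proof.
have -> : (x + 1)%R = (x.+1 %% N.+3)%N :> nat by rewrite /= (@modn_small 1 N.+3) // addn1.
case: (ltnP x N.+2) => h; first by right; rewrite modn_small.
left; have ex : x = N.+2 :> nat by case: x h => x /= ? ?; lia.
split=> //; by apply: val_inj => /=; rewrite ex (@modn_small 1 N.+3) // addn1 modnn.
Qed.

Lemma ord_step (x y : A) : y = x \/ y = x + 1 ->
  [\/ y = x :> nat, x = N.+2 :> nat /\ y = 0%N :> nat | y = x.+1 :> nat].
Proof.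
case=> ->; first by constructor 1.
by have [[-> ->]|->] := ord_succ x; [constructor 2 | constructor 3].
Qed.

(** On a small sequence a coordinate decreases only by passing from N + 2 to 0, so this cocycle
    represents the generator of the first cohomology of the k-th circle. *)
Definition wrap (k : 'I_m.+1) (w : nat -> V) : int := (w 1%N k < w 0%N k)%N%:Z.

Lemma local_wrap k : local_upto 1 (wrap k).
Proof. by move=> w w' e; rewrite /wrap !e. Qed.

Lemma codiff1 (W : Type) (f : (nat -> W) -> int) w :
  codiff 1 f w = f (w \o bump 0) - f (w \o bump 1) + f (w \o bump 2).
Proof. by rewrite /codiff !big_ord_recl big_ord0 /= /bump /= !(expr0, expr1); ring. Qed.

Lemma closed_wrap k : closed_on small 1 (wrap k).
Proof.
move=> w sw; rewrite codiff1 /wrap /= /bump /=.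
have := ord_step (sw 0%N 1%N k isT); have := ord_step (sw 1%N 2%N k isT).
have := ord_step (sw 0%N 2%N k isT).
move: (w 0%N k) (w 1%N k) (w 2%N k) => [x hx] [y hy] [z hz] /=.
by case=> h1; case=> h2; case=> h3; lia.
Qed.

(** Generator of the second cohomology of the j-th 2-torus, pulled back to the whole torus. *)
Definition chern (j : 'I_n1) : (nat -> V) -> int :=
  cup 1 (wrap (evc j)) (wrap (odc j)).

Lemma local_chern j : local_upto 2 (chern j).
Proof. exact: (@local_cup _ 1 1 _ _ (@local_wrap _) (@local_wrap _)). Qed.

Lemma closed_chern j : closed_on small 2 (chern j).
Proof.
apply: (@closed_cup _ small small_shift 1 1 _ _); try exact: local_wrap.
  exact: closed_wrap.
exact: closed_wrap.
Qed.

Lemma wrap_stair k p v s :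
  wrap k (shift p (stair (1 : A) v s)) = ((s k == p :> nat) && (v k == ord_max))%:Z.
Proof.
rewrite /wrap /shift !ffunE addn0 addn1 ltnS; congr (Posz (nat_of_bool _)).
case: (ltngtP (s k) p) => h; rewrite ?(mulr0n, mulr1n, addr0) ?ltnn //.
have [[-> e]|e] := ord_succ (v k).
  by rewrite e; apply/esym/eqP/val_inj.
rewrite e ltnNge leqnSn /=; apply/esym/negP => /eqP f.
by move: (ltn_ord (v k + 1)); rewrite e f /= ltnn.
Qed.

Lemma chern_stair j p v s : chern j (shift p (stair (1 : A) v s)) =
  [&& s (evc j) == p :> nat, s (odc j) == p.+1 :> nat,
      v (evc j) == ord_max & v (odc j) == ord_max]%:Z.
Proof.
rewrite /chern /cup wrap_stair.
have -> : wrap (odc j) (shift 1 (shift p (stair (1 : A) v s))) =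
          wrap (odc j) (shift p.+1 (stair (1 : A) v s)).
  by apply: local_wrap => q _; rewrite /shift addnCA add1n addSn.
by rewrite wrap_stair; do 4!case: (_ == _).
Qed.

(** If [f] is injective, exactly one simplex contributes: all coordinates start at the maximum, and
    the order of steps is the inverse of a block permutation, hence even. If [f] repeats a value,
    one coordinate would need two different ranks. *)
Lemma integral_chern (f : 'I_n1 -> 'I_n1) :
  integral (1 : A) (fun w => \prod_(i < n1) chern (f i) (shift i.*2 w)) =
  (injectiveb f)%:Z.
Proof.
pose c (v : V) (s : 'S_m.+1) := [forall i : 'I_n1,
   [&& s (evc (f i)) == i.*2 :> nat, s (odc (f i)) == i.*2.+1 :> nat,
      v (evc (f i)) == ord_max & v (odc (f i)) == ord_max]].
have prodE v s : \prod_(i < n1) chern (f i) (shift i.*2 (stair (1 : A) v s)) = (c v s)%:Z.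
  case: (boolP (c v s)) => [/forallP h|/forallPn[i hi]].
    by apply: big1 => i _; rewrite chern_stair h.
  by rewrite (bigD1 i) //= chern_stair (negbTE hi) mul0r.
rewrite /integral.
case: (boolP (injectiveb f)) => [/injectiveP fi|fni].
  pose g : 'S_n1 := perm fi.
  pose v0 : V := [ffun _ => ord_max].
  pose s0 : 'S_m.+1 := ((block_perm g)^-1)%g.
  have s0e i : s0 (evc (f i)) = evc i.
    by apply: (canLR (permK _)); rewrite block_perm_ev permE.
  have s0o i : s0 (odc (f i)) = odc i.
    by apply: (canLR (permK _)); rewrite block_perm_od permE.
  have c0 v s : c v s = (v == v0) && (s == s0).
    apply/forallP/andP => [h|[/eqP -> /eqP ->] i]; last first.
      by rewrite s0e s0o evcE odcE !ffunE !eqxx.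
    have fs j : exists i, j = f i by exists ((g^-1)%g j); rewrite -[f _](permE fi) permKV.
    split; apply/eqP.
      apply/ffunP => k; rewrite ffunE; case: (coordP k) => j.
        by have [i ->] := fs j; case/and4P: (h i) => _ _ /eqP.
      by have [i ->] := fs j; case/and4P: (h i) => _ _ _ /eqP.
    apply/permP => k; case: (coordP k) => j; have [i ->] := fs j; apply: val_inj.
      by rewrite s0e /= evcE; case/and4P: (h i) => /eqP.
    by rewrite s0o /= odcE; case/and4P: (h i) => _ /eqP.
  rewrite (bigD1 v0) //= [X in _ + X]big1 ?addr0 => [|v vv]; last first.
    by apply: big1 => s _; rewrite prodE c0 (negbTE vv) mulr0.
  rewrite (bigD1 s0) //= [X in _ + X]big1 ?addr0 => [|s ss]; last first.
    by rewrite prodE c0 (negbTE ss) andbF mulr0.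
  by rewrite prodE c0 !eqxx odd_permV odd_block_perm mul1r.
apply: big1 => v _; apply: big1 => s _; rewrite prodE.
case: (boolP (c v s)) => [/forallP h|_]; last by rewrite mulr0.
case/negP: fni; apply/injectiveP => i j e.
case/and4P: (h i) => /eqP hi _ _ _; case/and4P: (h j) => /eqP hj _ _ _.
by apply: val_inj => /=; move: hi; rewrite e hj; lia.
Qed.

(** Expanding the product of sums over all maps [f], only the bijections survive, which leaves the
    permanent. *)
Lemma integral_cupn_chern (a : 'I_n1 -> 'I_n1 -> int) :
  integral (1 : A) (cupn n1 (fun i w => \sum_j a (inord i) j * chern j w)) =
  \sum_(s : 'S_n1) \prod_i a i (s i).
Proof.
transitivity (\sum_(f : {ffun 'I_n1 -> 'I_n1}) (\prod_i a i (f i)) *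
   integral (1 : A) (fun w => \prod_(i < n1) chern (f i) (shift i.*2 w))).
  rewrite /integral; under [RHS]eq_bigr do rewrite mulr_sumr.
  rewrite [RHS]exchange_big; apply: eq_bigr => v _ /=.
  under [RHS]eq_bigr do rewrite mulr_sumr.
  rewrite [RHS]exchange_big; apply: eq_bigr => s _ /=.
  rewrite /cupn bigA_distr_bigA mulr_sumr; apply: eq_bigr => f _ /=.
  rewrite big_split /= mulrCA; congr (_ * (_ * _)).
  by apply: eq_bigr => i _; rewrite inord_val.
under eq_bigr do rewrite integral_chern.
rewrite [LHS](bigID (fun f : {ffun 'I_n1 -> 'I_n1} => injectiveb f)) /=.
rewrite [X in _ + X]big1 ?addr0 => [|f /negbTE ->]; last by rewrite mulr0.
rewrite (reindex (fun s : 'S_n1 => pval s)) /=; last first.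
  exists (fun f => insubd (1%g : 'S_n1) f) => [s _|f fi] /=; first exact: valKd.
  by rewrite (@insubdK _ _ _ (1%g : 'S_n1)).
apply: eq_big => [s|s _]; first exact: (valP s).
have -> : injectiveb (pval s) by exact: (valP s).
by rewrite mulr1; apply: eq_bigr => i _; rewrite -pvalE.
Qed.

End Wrap.

(** * Phases of sections *)

Lemma codiff2 (W : Type) (f : (nat -> W) -> int) w :
  codiff 2 f w = f (w \o bump 0) - f (w \o bump 1) + f (w \o bump 2) - f (w \o bump 3).
Proof.
rewrite /codiff !big_ord_recl big_ord0 /= /bump /= addr0 !exprS expr0 !mulr1 !mulN1r opprK !mul1r.
by rewrite !addrA.
Qed.

Lemma codiff_codiff1 (W : Type) (F : W -> W -> int) w :
  codiff 2 (codiff 1 (fun w => F (w 0%N) (w 1%N))) w = 0.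
Proof. by rewrite codiff2 !codiff1 /= /bump /=; ring. Qed.

Section Phases.
Variables (R : realType) (N n : nat).
Local Notation n1 := n.+1.
Local Notation m := n.*2.+1.
Local Notation A := 'I_N.+3.
Local Notation V := {ffun 'I_m.+1 -> A}.
Implicit Types (u v : V).

(** Discrete connection, measured in full turns: the phase of the clutching functions met on the
    edge from [u] to [v], one for each [evc j] that wraps. *)
Definition transport (a : 'I_n1 -> int) u v : R :=
  \sum_j (a j)%:~R * ((v (evc j) < u (evc j))%N%:R * ((v (odc j))%:R / N.+3%:R)).

(** The curvature of the connection is the integer cocycle up to an error of one mesh per j: the
    position of [odc j] moves by at most one grid step between the vertices 1 and 2. *)
Lemma transport_curvature (a : 'I_n1 -> int) (w : nat -> V) :
  (forall j, `|a j| <= 1) -> small w ->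
  `| transport a (w 1%N) (w 2%N) - transport a (w 0%N) (w 2%N)
     + transport a (w 0%N) (w 1%N) - (\sum_j a j * chern j w)%:~R |
  <= n1%:R / N.+3%:R.
Proof.
move=> a1 sw; rewrite rmorph_sum /= /transport -sumrN -!big_split -sumrN -big_split /=.
apply: le_trans (ler_norm_sum _ _ _) _.
have -> : n1%:R / N.+3%:R = \sum_(j < n1) (N.+3%:R^-1 : R).
  by rewrite sumr_const card_ord mulr_natl.
apply: ler_sum => j _.
have := closed_wrap (evc j) sw; rewrite codiff1 /wrap /= /bump /= => cw.
rewrite /chern /cup /wrap /shift /= addn0.
have {}cw : ((w 2%N (evc j) < w 1%N (evc j))%N%:R : R) =
   (w 2%N (evc j) < w 0%N (evc j))%N%:R - (w 1%N (evc j) < w 0%N (evc j))%N%:R.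
  by move: cw; case: (_ < _)%N; case: (_ < _)%N; case: (_ < _)%N => //= _; rewrite ?subr0 ?subrr.
rewrite cw; set b := (w 1%N (evc j) < w 0%N (evc j))%N.
set c := (w 2%N (evc j) < w 0%N (evc j))%N.
have H := ord_step (sw 1%N 2%N (odc j) isT).
move: (w 1%N (odc j)) (w 2%N (odc j)) H => [x hx] [y hy] /= H.
have N0 : (N.+3%:R : R) != 0 by rewrite pnatr_eq0.
(* [d] records whether [odc j] steps on the edge from vertex 1 to vertex 2. *)
have E : exists2 d : bool, True &
    (x%:R / N.+3%:R - y%:R / N.+3%:R : R) = (y < x)%N%:R - d%:R / N.+3%:R.
  case: H => [->|[-> ->]|->].
  - by exists false => //; rewrite ltnn subrr mul0r subr0.
  - exists true => //=; rewrite mul0r subr0.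
    have -> : (N.+2%:R : R) = N.+3%:R - 1 by rewrite -[N.+3%:R]natr1 addrK.
    by rewrite mulrBl divff.
  exists true => //; rewrite ltnNge leqnSn -[x.+1%:R]natr1 -mulrBl opprD addrA subrr.
  by rewrite !sub0r mulNr.
have [d _ {}E] := E.
have -> : (a j)%:~R * ((c%:R - b%:R) * (y%:R / N.+3%:R)) +
    - ((a j)%:~R * (c%:R * (y%:R / N.+3%:R))) +
    (a j)%:~R * (b%:R * (x%:R / N.+3%:R)) +
    - (a j * (b%:Z * (y < x)%N%:Z))%:~R =
   - ((a j)%:~R * (b%:R * d%:R)) / N.+3%:R :> R.
  transitivity ((a j)%:~R * (b%:R * ((x%:R / N.+3%:R - y%:R / N.+3%:R) - (y < x)%N%:R)) : R).
    by rewrite !rmorphM /= !pmulrn; ring.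
  by rewrite E; ring.
rewrite !normrM normrN normrM normfV normr_nat -[leRHS]mul1r ler_pM2r ?invr_gt0 ?ltr0n //.
rewrite -[leRHS]mul1r ler_pM //.
  by rewrite -intr_norm -[1]/(1%:~R) ler_int a1.
by case: b; case: (d); rewrite /= ?mulr0 ?mul0r ?mulr1 ?normr0 ?normr1.
Qed.

(* Rounding the phase increments [X i] gives an integer 1-cochain. Subtracting its
   coboundary from the i-th cocycle leaves a combination of curvature and rounding
   errors, which is an integer of absolute value less than 1 on slow simplices. *)
Theorem slow_phase_obstruction (a : 'I_n1 -> 'I_n1 -> int) (t : 'I_n1 -> V -> R) :
    (forall i j, `|a i j| <= 1) -> (4 * n1 <= N.+3)%N ->
    \sum_(s : 'S_n1) \prod_i a i (s i) != 0 ->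
  exists v s, forall i, exists p q, (p <= q)%N /\
    let u := stair (1 : A) v s p in let u' := stair (1 : A) v s q in
    forall z : int, 1 / 8 <= `| t i u' - t i u + transport (a i) u u' - z%:~R |.
Proof.
move=> a1 nN per0.
pose X i u u' := t i u' - t i u + transport (a i) u u'.
(* Nearest integer to the increment [X]. *)
pose mm i u u' : int := Num.floor (X i u u' + 1 / 2).
pose slow v s i := forall p q, (p <= q)%N -> exists z : int,
  `|X i (stair (1 : A) v s p) (stair (1 : A) v s q) - z%:~R| < 1 / 8.
suff [v [s H]] : exists v s, forall i, ~ slow v s i.
  exists v, s => i; apply: contrapT => H1; apply: (H i) => p q pq.
  apply: contrapT => H2; apply: H1; exists p, q; split=> // u u' z.
  by rewrite leNgt; apply/negP => H3; apply: H2; exists z.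
apply: contrapT => H.
have {}H v s : exists i, slow v s i.
  apply: contrapT => H1; apply: H; exists v, s => i H2; apply: H1.
  by exists i.
move: per0; rewrite -(integral_cupn_chern N) => /eqP; apply.
pose c' (k : nat) (w : nat -> V) : int := \sum_j a (inord k) j * chern j w.
pose al (k : nat) (w : nat -> V) : int := - mm (inord k) (w 0%N) (w 1%N).
pose c (k : nat) (w : nat -> V) : int := c' k w + codiff 1 (al k) w.
have lc' k : local_upto 2 (c' k).
  by move=> w w' e; apply: eq_bigr => j _; rewrite (@local_chern _ _ j _ _ e).
have lal k : local_upto 1 (al k) by move=> w w' e; rewrite /al !e.
have cc' k : closed_on (@small N n) 2 (c' k).
  move=> w sw; rewrite codiff2 /c' -!sumrN -!big_split /= big1 // => j _.
  have := closed_chern j sw; rewrite codiff2 => E.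
  by rewrite -[RHS](mulr0 (a (inord k) j)) -E; ring.
have lc k : local_upto 2 (c k).
  move=> w w' e; rewrite /c (lc' k _ _ e); congr (_ + _).
  by rewrite !codiff1 /al /= /bump /= !e.
have cc k : closed_on (@small N n) 2 (c k).
  move=> w sw; move: (cc' k w sw) (codiff_codiff1 (fun u u' => - mm (inord k) u u') w).
  rewrite /c /al !codiff2; lia.
rewrite (@integral_cupn_cohomologous _ _ _ (@small N n) _ _ n1 c' c al) //.
- rewrite /integral big1 // => v _; rewrite big1 // => s _.
  have [i sl] := H v s.
  (* A single slow section kills the whole product on this simplex, through its own factor. *)
  suff ci : c i (shift i.*2 (stair (1 : A) v s)) = 0.
    by rewrite /cupn (bigD1 i) //= ci mul0r mulr0.
  set w := shift i.*2 (stair (1 : A) v s).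
  have sw : small w by apply/small_shift/small_stair.
  have mX p q : (p <= q)%N -> `|X i (w p) (w q) - (mm i (w p) (w q))%:~R| < 1 / 8.
    move=> pq; have [|z hz] := sl (i.*2 + p)%N (i.*2 + q)%N; first by rewrite leq_add2l.
    suff -> : mm i (w p) (w q) = z by [].
    apply/eqP; rewrite /mm floor_eq.
    rewrite -[stair _ v s _]/(w p) -[stair _ v s (_ + q)]/(w q) in hz *.
    move: hz; rewrite ltr_norml intrD; lra.
  have := transport_curvature (a1 i) sw.
  have := mX 0%N 1%N isT; have := mX 1%N 2%N isT; have := mX 0%N 2%N isT.
  rewrite /c codiff1 /al /= /bump /= inord_val /c' inord_val.
  have nN' : (n1%:R / N.+3%:R : R) <= 1 / 4.
    rewrite ler_pdivrMr ?ltr0n //; have : ((4 * n1)%:R : R) <= N.+3%:R by rewrite ler_nat.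
    by rewrite natrM; lra.
  rewrite /X; set C := \sum_j _.
  move: (mm _ (w 0%N) (w 1%N)) (mm _ (w 1%N) (w 2%N)) (mm _ (w 0%N) (w 2%N)) => x y z.
  move=> h1 h2 h3 h4.
  (* The increments of [t] cancel around the triangle. The curvature error is at most 1/4 and each
     of the three rounding errors is below 1/8, so the total is below 5/8. *)
  suff : `|(C + (- y - - z + - x))%:~R : R| < 1.
    by rewrite -intr_norm -[1]/(1%:~R) ltr_int; lia.
  move: h1 h2 h3 h4; rewrite !rmorphD !rmorphN /= !ltr_norml ler_norml.
  move: nN'; move: (_ / N.+3%:R) => K; move: (transport _ _ _) => T1.
  move: (transport _ _ _) => T2; move: (transport _ _ _) => T3.
  move: (t i _) (t i _) (t i _) => t1 t2 t3; lra.
- by move=> p w; exact: small_shift.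
- by move=> v s; exact: small_stair.
Qed.

End Phases.

(** * Common zeros of sections *)

Local Notation normc := Normc.normc.

(** * Phases of complex numbers *)

Section ComplexPhase.
Variable R : realType.
Local Notation C := (R[i]).
Implicit Types (x y t : R) (z : C).

Definition cis x : C := Complex (cos x) (sin x).

Lemma cisD x y : cis (x + y) = cis x * cis y.
Proof. by apply/eqP; rewrite eq_complex /= cosD sinD addrC [cos x * sin y + _]addrC !eqxx. Qed.

Lemma cis0 : cis 0 = 1.
Proof. by rewrite /cis cos0 sin0. Qed.

Lemma cis_sum (I : finType) (f : I -> R) : cis (\sum_i f i) = \prod_i cis (f i).
Proof. exact: (big_morph cis cisD cis0). Qed.

Lemma conjc_cis x : conjc (cis x) = cis (- x).
Proof. by rewrite /cis cosN sinN. Qed.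

Lemma normc_cis x : normc (cis x) = 1.
Proof. by rewrite /= cos2Dsin2 sqrtr1. Qed.

Lemma normc_ge0 z : 0 <= normc z.
Proof. by case: z => a b; exact: sqrtr_ge0. Qed.

Lemma normcB z z' : normc (z - z') = normc (z' - z).
Proof. by rewrite -opprB; exact: normcN. Qed.

Lemma normc_le_sub z z' : normc z <= normc (z - z') + normc z'.
Proof. by rewrite -{1}(subrK z' z); exact: le_normcD. Qed.

Lemma normc_sqr (a b : R) : normc (Complex a b) ^+ 2 = a ^+ 2 + b ^+ 2.
Proof. by rewrite /= sqr_sqrtr // addr_ge0 // sqr_ge0. Qed.

Lemma cos_sin_ex (a b : R) : a ^+ 2 + b ^+ 2 = 1 -> exists x, a = cos x /\ b = sin x.
Proof.
move=> ab; have a1 : -1 <= a <= 1 by nra.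
have ca : cos (acos a) = a by rewrite acosK // in_itv.
have sb : b ^+ 2 = sin (acos a) ^+ 2 by rewrite sin2cos2 ca -ab; ring.
have /eqP := sb; rewrite eqf_sqr => /orP[/eqP ->|/eqP ->].
  by exists (acos a).
by exists (- acos a); rewrite cosN sinN.
Qed.

Lemma phase_ex z : exists t, z = (normc z)%:C%C * cis (2 * pi * t).
Proof.
have [/Normc.eq0_normc ->|z0] := eqVneq (normc z) 0.
  by exists 0; rewrite Normc.normc0 mul0r.
case: z z0 => a b; set r := normc _ => r0.
have [x [ax bx]] : exists x, a / r = cos x /\ b / r = sin x.
  apply: cos_sin_ex; rewrite !expr_div_n -mulrDl -normc_sqr divff //.
  by rewrite expf_neq0.
exists (x / (2 * pi)); rewrite [2 * pi * _]mulrC divfK; last first.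
  by rewrite mulf_neq0 // gt_eqF // pi_gt0.
apply/eqP; rewrite eq_complex /= -ax -bx !mul0r subr0 addr0.
by rewrite !(mulrC r) !divfK ?eqxx.
Qed.

Lemma cos_period (k : int) x : cos (x + 2 * pi * k%:~R) = cos x.
Proof.
have E y n : cos (y + 2 * pi * n%:R) = cos y :> R.
  rewrite -[RHS](periodicn (@cosD2pi R) n y); congr (cos (_ + _)).
  by rewrite mulr_natr mulr_natl.
case: k => n; first exact: E.
by rewrite NegzE mulrNz mulrN -{2}[x](subrK (2 * pi * n.+1%:R)) E.
Qed.

(** The angle stays at least pi/4 away from the multiples of 2 pi, so its cosine is at most that of
    pi/4, whose square is 1/2. *)
Lemma cos_gap t : (forall k : int, 1 / 8 <= `|t - k%:~R|) ->
  cos (2 * pi * t) <= 0 \/ cos (2 * pi * t) ^+ 2 <= 1 / 2.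
Proof.
move=> gap; pose k := Num.floor (t + 1 / 2).
have kt : k%:~R <= t + 1 / 2 < (k + 1)%:~R by rewrite floor_itv.
have {gap} := gap k; set d := t - k%:~R => gap.
have d2 : `|d| <= 1 / 2 by move: kt; rewrite intrD ler_norml /d; lra.
have -> : cos (2 * pi * t) = cos (2 * pi * `|d|).
  have -> : 2 * pi * t = 2 * pi * d + 2 * pi * k%:~R :> R by rewrite /d; ring.
  by rewrite cos_period; case: (ger0P d) => // _; rewrite mulrN cosN.
have p0 := pi_gt0 R.
have le : cos (2 * pi * `|d|) <= cos (pi / 4).
  have [->|ne] := eqVneq (2 * pi * `|d|) (pi / 4) => //.
  apply/ltW; rewrite ltr_cos ?in_itv /=; nra.
have c4 : cos (pi / 4) ^+ 2 = 1 / 2 :> R.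
  have : cos (pi / 4 *+ 2) = 0 :> R.
    have -> : pi / 4 *+ 2 = pi / 2 :> R by rewrite -mulr_natr; field.
    by rewrite cos_pihalf.
  by rewrite cos_mulr2n -mulr_natl => h; lra.
by case: (lerP (cos (2 * pi * `|d|)) 0) => [|pos]; [left | right; nra].
Qed.

(** Law of cosines, with r, r' the moduli and k the cosine of the angle between: r^2 + r'^2 - 2 r r'
    k is at least r^2 if k <= 0, and otherwise equals (r' - r k)^2 + r^2 (1 - k^2), which is at
    least r^2 / 2. *)
Lemma phase_gap z z' t t' :
    z = (normc z)%:C%C * cis (2 * pi * t) -> z' = (normc z')%:C%C * cis (2 * pi * t') ->
    (forall k : int, 1 / 8 <= `|t' - t - k%:~R|) ->
  normc z <= 2 * normc (z - z').
Proof.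
move=> ez ez' /cos_gap; rewrite mulrBr cosB.
have r0 := normc_ge0 z; have r0' := normc_ge0 z'.
set k := (X in X <= 0 \/ _) => hk.
have D : normc (z - z') ^+ 2 = normc z ^+ 2 + normc z' ^+ 2 - 2 * (normc z * normc z') * k.
  have T u : sin u ^+ 2 = 1 - cos u ^+ 2 :> R by rewrite sin2cos2.
  rewrite {1}ez {1}ez' normc_sqr !mul0r !subr0 !addr0 /k.
  move: (normc z) (normc z') (T (2 * pi * t)) (T (2 * pi * t')) => r r'.
  move: (cos (2 * pi * t)) (sin (2 * pi * t)) (cos (2 * pi * t')) (sin (2 * pi * t')).
  move=> c1 s1 c2 s2 e1 e2.
  transitivity (r ^+ 2 * (c1 ^+ 2 + s1 ^+ 2) + r' ^+ 2 * (c2 ^+ 2 + s2 ^+ 2)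
    - 2 * (r * r') * (c2 * c1 + s2 * s1)); first by ring.
  by rewrite e1 e2; ring.
have d0 := normc_ge0 (z - z').
rewrite -ler_sqr ?nnegrE ?mulr_ge0 // exprMn D.
move: (normc z) (normc z') r0 r0' => r r' r0 r0'.
have rr : 0 <= r * r' by exact: mulr_ge0.
have r2 : 0 <= r ^+ 2 by exact: sqr_ge0.
case: hk => hk.
  have : 0 <= - (r * r' * k) by rewrite -mulrN mulr_ge0 // oppr_ge0.
  have : 0 <= r' ^+ 2 by exact: sqr_ge0.
  lra.
have : 0 <= (r' - r * k) ^+ 2 by exact: sqr_ge0.
have : 0 <= r ^+ 2 * (1 / 2 - k ^+ 2) by rewrite mulr_ge0 ?sqr_ge0 // subr_ge0.
lra.
Qed.

End ComplexPhase.

(** * From the grid to a common zero *)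

Section TorusZero.
Variables (R : realType) (n : nat).
Local Notation n1 := n.+1.
Local Notation M := n.*2.+2.
Local Notation C := (R[i]).
Implicit Types (x y : 'I_M -> R).

Definition in_cube x := forall k, 0 <= x k <= 1.

Definition near_by (d : R) x y := forall k, `|x k - y k| <= d.

Lemma cube_cluster (f : nat -> 'I_M -> R) : (forall N, in_cube (f N)) ->
  exists2 x, in_cube x &
    forall d N0, 0 < d -> exists2 N, (N0 <= N)%N & near_by d (f N) x.
Proof.
move=> fc.
pose A := [set v : 'rV[R]_M | forall i, `[0, 1]%classic (v ord0 i)]%classic.
have cA : compact A.
  by apply: (@rV_compact R M (fun _ => `[0, 1]%classic)) => _; exact: segment_compact.
pose g N : 'rV[R]_M := \row_k f N k.
have gA : (nbhs (g @ \oo)%classic) A.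
  by exists 0%N => // N _ i /=; rewrite mxE /= in_itv; exact: fc.
have [v [Av cv]] := cA _ _ gA.
exists (fun k => v ord0 k) => [k|d N0 d0]; first by have := Av k; rewrite /= in_itv.
pose B := [set u : 'rV[R]_M | exists2 N, (N0 <= N)%N & u = g N]%classic.
have gB : (nbhs (g @ \oo)%classic) B by exists N0 => // N /= hN; exists N.
have [u [[N hN ->] [_ bu]]] := cv _ _ gB (nbhsx_ballx v d d0).
exists N => // k; have := bu ord0 k; rewrite /= mxE /ball /= => h.
by rewrite distrC ltW.
Qed.

Section Sections.
Variables (a : 'I_n1 -> 'I_n1 -> int) (F : 'I_n1 -> ('I_M -> R) -> C) (L : R).
Hypothesis a_le1 : forall i j, `|a i j| <= 1.
Hypothesis per_neq0 : \sum_(s : 'S_n1) \prod_i a i (s i) != 0.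
Hypothesis F_lip : forall i x y d, in_cube x -> in_cube y -> near_by d x y ->
  normc (F i x - F i y) <= L * d.
(* [F i] is a section of the line bundle on the torus whose clutching function
   along the circles [evc j] is [cis (2 pi a_ij x_(odc j))]. *)
Hypothesis F_twist : forall i x x0 (w : 'I_n1 -> bool),
  (forall j, x (odc j) = x0 (odc j) \/ (x (odc j) = 1 /\ x0 (odc j) = 0)) ->
  (forall j, if w j then x (evc j) = 1 /\ x0 (evc j) = 0 else x (evc j) = x0 (evc j)) ->
  F i x = cis (2 * pi * \sum_j (a i j)%:~R * ((w j)%:R * x0 (odc j))) * F i x0.

Section Grid.
Variable N : nat.
Hypothesis nN : (4 * n1 <= N.+3)%N.
Local Notation A := 'I_N.+3.
Local Notation V := {ffun 'I_M -> A}.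
Implicit Types (u v : V).

Definition grid u : 'I_M -> R := fun k => (u k)%:R / N.+3%:R.

(** The vertex [u'] as reached from [u] inside the cube: a coordinate that wraps ends at 1 instead
    of 0, so the point stays within one mesh of [grid u]. *)
Definition unwrap u u' : 'I_M -> R := fun k => (u k + (u' k != u k))%:R / N.+3%:R.

Lemma frac_itv (c : nat) : (c <= N.+3)%N -> 0 <= (c%:R / N.+3%:R : R) <= 1.
Proof.
move=> cN; rewrite divr_ge0 // ler_pdivrMr ?ltr0n // mul1r ler_nat.
exact: cN.
Qed.

Lemma grid_cube u : in_cube (grid u).
Proof. by move=> k; apply: frac_itv; exact: ltnW. Qed.

Lemma unwrap_cube u u' : in_cube (unwrap u u').
Proof.
move=> k; apply: frac_itv; case: (u k) => c hc /=.
by case: (_ == _) => /=; lia.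
Qed.

Lemma grid_unwrap u u' : near_by N.+3%:R^-1 (grid u) (unwrap u u').
Proof.
move=> k; rewrite /grid /unwrap natrD mulrDl opprD addrA subrr sub0r normrN.
rewrite normrM normfV !normr_nat -[leRHS]mul1r ler_pM2r ?invr_gt0 ?ltr0n //.
by rewrite lern1; case: (_ != _).
Qed.

Lemma unwrapP u u' k : u' k = u k \/ u' k = u k + 1 ->
  if (u' k < u k)%N then unwrap u u' k = 1 /\ grid u' k = 0 else unwrap u u' k = grid u' k.
Proof.
rewrite /unwrap /grid => -[->|e]; first by rewrite ltnn eqxx addn0.
have [[e1 e2]|e1] := ord_succ (u k); rewrite e.
  have -> : (u k + 1 != u k) by apply/eqP => h; move: e2; rewrite -h e1.
  by rewrite e1 e2 /= addn1 mul0r divff // pnatr_eq0.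
have -> : (u k + 1 != u k) by apply/eqP => h; move: e1; rewrite h; lia.
by rewrite e1 ltnNge leqnSn /= addn1.
Qed.

Lemma F_unwrap i u u' : (forall k, u' k = u k \/ u' k = u k + 1) ->
  F i (unwrap u u') = cis (2 * pi * transport R (a i) u u') * F i (grid u').
Proof.
move=> st; apply: (@F_twist i _ _ (fun j => (u' (evc j) < u (evc j))%N)) => j.
  by have := unwrapP (st (odc j)); case: ifP => _ h; [right|left].
exact: unwrapP (st (evc j)).
Qed.

(** On a simplex without slow section, each section has an edge from u to u' along which its phase
    jumps while its value moves by at most L / (N + 3); by [phase_gap] it is small at u. Passing
    from u to the base vertex [v] costs one more such step. *)
Lemma small_values : exists v, forall i, normc (F i (grid v)) <= 3 * (L / N.+3%:R).
Proof.
have [t ht] := choice (fun iu : 'I_n1 * V => phase_ex (F iu.1 (grid iu.2))).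
have [v [s H]] := @slow_phase_obstruction R N n a (fun i u => t (i, u)) a_le1 nN per_neq0.
exists v => i; have [p [q [pq gap]]] := H i.
set u := stair _ v s p in gap; set u' := stair _ v s q in gap.
have st : forall k, u' k = u k \/ u' k = u k + 1 by move=> k; exact: small_stair.
have st0 : forall k, u k = v k \/ u k = v k + 1.
  by move=> k; rewrite ffunE; case: (_ < _)%N; rewrite ?addr0; [right|left].
have nu : normc (F i (grid u)) <= 2 * (L / N.+3%:R).
  apply: (@le_trans _ _ (2 * normc (F i (grid u) - F i (unwrap u u')))); last first.
    rewrite ler_pM2l //; apply: F_lip; [exact: grid_cube|exact: unwrap_cube|exact: grid_unwrap].
  apply: (@phase_gap _ _ _ (t (i, u)) (t (i, u') + transport R (a i) u u')).
  - exact: (ht (i, u)).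
  - rewrite F_unwrap // Normc.normcM normc_cis mul1r [2 * pi * (_ + _)]mulrDr cisD mulrA.
    by rewrite -[X in X * cis _](ht (i, u')) mulrC.
  - by move=> k; rewrite [_ + transport _ _ _ _ - _]addrAC; exact: gap.
have nv : normc (F i (unwrap v u)) <= 2 * (L / N.+3%:R).
  by rewrite F_unwrap // Normc.normcM normc_cis mul1r.
apply: le_trans (normc_le_sub _ (F i (unwrap v u))) _.
rewrite [leRHS](_ : _ = L / N.+3%:R + 2 * (L / N.+3%:R)); last by ring.
by apply: lerD => //; apply: F_lip; [exact: grid_cube|exact: unwrap_cube|exact: grid_unwrap].
Qed.

End Grid.

Theorem common_zero : exists2 x, in_cube x & forall i, F i x = 0.
Proof.
(* The offset [4 * n1] makes every grid of the sequence fine enough. *)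
have V_ N : exists x, in_cube x /\
    forall i, normc (F i x) <= 3 * (L / (4 * n1 + N).+3%:R).
  have [|v hv] := @small_values (4 * n1 + N); first by lia.
  by exists (grid v); split=> //; exact: grid_cube.
have [f hf] := choice V_.
have [x xc hx] := cube_cluster (fun N => (hf N).1).
exists x => // i; apply: Normc.eq0_normc; apply/eqP; rewrite eq_le normc_ge0 andbT.
have L0 : 0 <= L.
  have xx : near_by 1 x x by move=> k; rewrite subrr normr0.
  by have := F_lip i xc xc xx; rewrite subrr Normc.normc0 mulr1.
apply/ler_addgt0Pl => e e0; rewrite addr0.
(* Chosen so that L d for the distance to the cluster point and 3 L d for the grid value add up to
   at most [e]. *)
pose d := e / (4 * (L + 1)).
have d0 : 0 < d by rewrite divr_gt0 // mulr_gt0 // ltr_pwDr.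
have [N0 hN0] : exists N0 : nat, d^-1 < N0%:R by exists (Num.truncn d^-1).+1; rewrite truncnS_gt.
have [N hN nN] := hx d N0 d0.
have h1 := (hf N).2 i.
have h2 := F_lip i (hf N).1 xc nN.
have := normc_le_sub (F i x) (F i (f N)).
rewrite [normc (F i x - _)]normcB => h3.
have Nd : ((4 * n1 + N).+3%:R : R)^-1 <= d.
  rewrite -[d]invrK lef_pV2 ?posrE ?invr_gt0 ?ltr0n //.
  by apply: le_trans (ltW hN0) _; rewrite ler_nat; lia.
have Ld : L / (4 * n1 + N).+3%:R <= L * d by rewrite ler_wpM2l.
have -> : e = L * d + (3 * (L * d) + 4 * d).
  by rewrite /d; field; rewrite gt_eqF // ltr_pwDr.
apply: le_trans h3 _; apply: lerD => //; apply: le_trans h1 _.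
by apply: ler_wpDr; [rewrite mulr_ge0 ?(ltW d0) | rewrite ler_pM2l].
Qed.

End Sections.
End TorusZero.

(** * Orthogonal complements *)

Section OrthogonalComplement.
Variables (R : realType) (n : nat).
Local Notation C := (R[i]).
Implicit Types (u v w : qspace R n) (D : {vspace qspace R n}).

Lemma qdotDl u v w : qdot (u + v) w = qdot u w + qdot v w.
Proof. by rewrite /qdot -big_split; apply: eq_bigr => x _; rewrite ffunE mulrDl. Qed.

Lemma qdotZl (c : C) u w : qdot (c *: u) w = c * qdot u w.
Proof. by rewrite /qdot mulr_sumr; apply: eq_bigr => x _; rewrite ffunE mulrA. Qed.

Lemma qdotC u w : qdot w u = (qdot u w)^*.
Proof.
rewrite /qdot rmorph_sum; apply: eq_bigr => x _.
by rewrite rmorphM /= conjCK mulrC.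
Qed.

Lemma qdotDr u v w : qdot w (u + v) = qdot w u + qdot w v.
Proof. by rewrite qdotC qdotDl rmorphD /= -!qdotC. Qed.

Lemma qdotZr (c : C) u w : qdot w (c *: u) = c^* * qdot w u.
Proof. by rewrite qdotC qdotZl rmorphM /= -qdotC. Qed.

Lemma qdot0r w : qdot w 0 = 0.
Proof. by rewrite /qdot big1 // => x _; rewrite ffunE conjC0 mulr0. Qed.

Lemma qdot_sumr (I : finType) (f : I -> qspace R n) w :
  qdot w (\sum_i f i) = \sum_i qdot w (f i).
Proof. by apply: (big_morph (qdot w)) => [u v|]; [exact: qdotDr | exact: qdot0r]. Qed.

Lemma qdot_eq0 u : (qdot u u == 0) = (u == 0).
Proof.
apply/eqP/eqP => [h|->]; last exact: qdot0r.
have nn x : true -> 0 <= u x * (u x)^* by rewrite mul_conjC_ge0.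
apply/ffunP => x; rewrite ffunE; apply/eqP.
by have /eqP := @psumr_eq0P _ _ _ _ nn h x isT; rewrite mul_conjC_eq0.
Qed.

(** The function under [linfun] in [qperp], named so that a linear structure can be declared on
    it. *)
Definition qrow D v : 'rV[C^o]_(\dim D) := \row_(i < \dim D) qdot v (tnth (vbasis D) i).

Lemma qrow_is_linear D : linear (qrow D).
Proof.
move=> c u v; apply/rowP => i; rewrite !mxE qdotDl qdotZl.
by [].
Qed.

HB.instance Definition _ D :=
  GRing.isLinear.Build C (qspace R n) 'rV[C^o]_(\dim D) *:%R (qrow D) (@qrow_is_linear D).

Lemma mem_qperp D v : reflect (forall u, u \in D -> qdot v u = 0) (v \in qperp D).
Proof.
rewrite /qperp -/(qrow D) memv_ker lfunE /=.
apply: (iffP eqP) => [h u uD|h].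
  rewrite (coord_vbasis uD) qdot_sumr big1 // => i _; rewrite qdotZr.
  move/rowP/(_ i): h; rewrite !mxE (tnth_nth 0) => ->.
  by rewrite mulr0.
by apply/rowP => i; rewrite !mxE h // vbasis_mem // mem_tnth.
Qed.

(** The double complement lies in [D]: counting dimensions, [D] and its complement span the space.
    Write w = d + e accordingly; orthogonality to [e] gives <e,e> = 0. *)
Lemma mem_qperp_dual D w :
  (forall e, e \in vbasis (qperp D) -> qdot w e = 0) -> w \in D.
Proof.
move=> h.
have {}h e : e \in qperp D -> qdot w e = 0.
  move=> eD; rewrite (coord_vbasis eD) qdot_sumr big1 // => i _.
  by rewrite qdotZr h ?mulr0 // mem_nth // size_tuple.
have cap0 : (D :&: qperp D)%VS = 0%VS.
  apply/eqP; rewrite -subv0; apply/subvP => v; rewrite memv_cap => /andP[vD /mem_qperp vp].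
  by rewrite memv0 -qdot_eq0 vp.
have dimD : (\dim {: qspace R n} <= \dim (qperp D) + \dim D)%N.
  rewrite /qperp -/(qrow D) -[X in (X <= _)%N](limg_ker_dim (linfun (qrow D)) fullv).
  rewrite capfv leq_add2l.
  apply: leq_trans (dimvS (subvf _)) _.
  by rewrite dimvf /dim /= mul1n.
have full : (D + qperp D)%VS = fullv.
  apply/eqP; rewrite eqEdim subvf /= dimv_disjoint_sum //.
  by rewrite addnC.
have : w \in (D + qperp D)%VS by rewrite full memvf.
case/memv_addP => d dD [e eD we].
suff e0 : e = 0 by rewrite we e0 addr0.
apply/eqP; rewrite -qdot_eq0; have := h e eD; rewrite we qdotDl.
by rewrite (qdotC e d) (mem_qperp _ _ eD) // conjC0 add0r => ->.
Qed.

End OrthogonalComplement.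

(** * Product vectors *)

Section LipschitzFunctions.
Variables (R : realType) (n : nat).
Local Notation M := n.*2.+2.
Local Notation C := (R[i]).
Implicit Types (f g : ('I_M -> R) -> C).

Lemma normc_le_ReIm (a b : R) : normc (Complex a b) <= `|a| + `|b|.
Proof.
rewrite -ler_sqr ?nnegrE ?addr_ge0 ?normc_ge0 // normc_sqr sqrrD !real_normK ?num_real //.
by rewrite addrAC lerDl mulrn_wge0 // mulr_ge0.
Qed.

Lemma lip_of_derive (f df : R -> R) : (forall x : R, is_derive x 1 f (df x)) ->
  (forall x, `|df x| <= 1) -> forall x y, `|f x - f y| <= `|x - y|.
Proof.
move=> fd df1 x y; wlog xy : x y / x <= y => [H|].
  by case/orP: (le_total x y) => h; [exact: H | rewrite distrC (distrC x); exact: H].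
have [c _ e] : exists2 c, c \in `[x, y] & f y - f x = df c * (y - x).
  apply: MVT_segment xy (fun z _ => fd z) _.
  apply: continuous_subspaceT => z; apply/differentiable_continuous/derivable1_diffP.
  by have := fd z; case.
by rewrite distrC e normrM (distrC x) ler_piMl.
Qed.

Lemma normc_cisB (x y : R) : normc (cis x - cis y) <= 2 * `|x - y|.
Proof.
apply: le_trans (normc_le_ReIm _ _) _; rewrite mulr2n mulrDl mul1r lerD //.
  apply: (@lip_of_derive cos (fun u => - sin u)) => u.
  by rewrite normrN ler_norml sin_geN1 sin_le1.
apply: (@lip_of_derive sin cos) => u.
by rewrite ler_norml cos_geN1 cos_le1.
Qed.

(** The bound on the values is carried along to make the class stable under products. *)
Definition lipschitzc f := exists2 K : R, 0 <= K &
  (forall x, in_cube x -> normc (f x) <= K) /\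
  (forall x y d, in_cube x -> in_cube y -> near_by d x y -> normc (f x - f y) <= K * d).

Lemma near_by_ge0 d (x y : 'I_M -> R) : near_by d x y -> 0 <= d.
Proof. by move/(_ ord0); apply: le_trans. Qed.

Lemma lipschitzc_cst (c : C) : lipschitzc (fun _ => c).
Proof.
exists (normc c); first exact: normc_ge0.
split=> // x y d _ _ /near_by_ge0 d0.
by rewrite subrr Normc.normc0 mulr_ge0 ?normc_ge0.
Qed.

Lemma lipschitzcD f g : lipschitzc f -> lipschitzc g -> lipschitzc (fun x => f x + g x).
Proof.
move=> [K K0 [fb fl]] [K' K'0 [gb gl]]; exists (K + K'); first exact: addr_ge0.
split=> [x xc|x y d xc yc xy].
  by apply: le_trans (le_normcD _ _) _; apply: lerD; [exact: fb|exact: gb].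
have -> : f x + g x - (f y + g y) = (f x - f y) + (g x - g y) by ring.
apply: le_trans (le_normcD _ _) _; rewrite mulrDl; apply: lerD; first exact: fl.
exact: gl.
Qed.

Lemma lipschitzcM f g : lipschitzc f -> lipschitzc g -> lipschitzc (fun x => f x * g x).
Proof.
move=> [K K0 [fb fl]] [K' K'0 [gb gl]]; exists (K * K' + K * K').
  by rewrite addr_ge0 // mulr_ge0.
split=> [x xc|x y d xc yc xy].
  rewrite Normc.normcM; apply: (@le_trans _ _ (K * K')); last by rewrite lerDl mulr_ge0.
  by apply: ler_pM; rewrite ?normc_ge0 //; [exact: fb|exact: gb].
have d0 := near_by_ge0 xy.
have -> : f x * g x - f y * g y = (f x - f y) * g x + f y * (g x - g y) by ring.
apply: le_trans (le_normcD _ _) _; rewrite [leRHS]mulrDl; apply: lerD; rewrite Normc.normcM.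
  rewrite mulrAC; apply: ler_pM; rewrite ?normc_ge0 //; [exact: fl|exact: gb].
by rewrite -mulrA; apply: ler_pM; rewrite ?normc_ge0 //; [exact: fb|exact: gl].
Qed.

Lemma lipschitzc_sum (I : finType) (f : I -> ('I_M -> R) -> C) :
  (forall i, lipschitzc (f i)) -> lipschitzc (fun x => \sum_i f i x).
Proof.
move=> fl; rewrite /index_enum; elim: (locked_with _ _) => [|i s IH].
  rewrite (_ : (fun _ => _) = fun _ => 0); first exact: lipschitzc_cst.
  by apply/funext => x; rewrite big_nil.
rewrite (_ : (fun _ => _) = fun x => f i x + \sum_(j <- s) f j x); first exact: lipschitzcD.
by apply/funext => x; rewrite big_cons.
Qed.

Lemma lipschitzc_prod (I : finType) (f : I -> ('I_M -> R) -> C) :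
  (forall i, lipschitzc (f i)) -> lipschitzc (fun x => \prod_i f i x).
Proof.
move=> fl; rewrite /index_enum; elim: (locked_with _ _) => [|i s IH].
  rewrite (_ : (fun _ => _) = fun _ => 1); first exact: lipschitzc_cst.
  by apply/funext => x; rewrite big_nil.
rewrite (_ : (fun _ => _) = fun x => f i x * \prod_(j <- s) f j x); first exact: lipschitzcM.
by apply/funext => x; rewrite big_cons.
Qed.

Lemma normc_conjc (z : C) : normc (conjc z) = normc z.
Proof. by case: z => a b; rewrite /= sqrrN. Qed.

Lemma lipschitzc_conj f : lipschitzc f -> lipschitzc (fun x => conjc (f x)).
Proof.
move=> [K K0 [fb fl]]; exists K => //; split=> [x xc|x y d xc yc xy].
  by rewrite normc_conjc; exact: fb.
by rewrite -rmorphB normc_conjc; exact: fl.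
Qed.

Lemma normc_real (a : R) : normc (a%:C)%C = `|a|.
Proof. by rewrite /= expr0n addr0 sqrtr_sqr. Qed.

Lemma lipschitzc_coord k : lipschitzc (fun x => ((x k)%:C)%C).
Proof.
exists 1 => //; split=> [x /(_ k) xc|x y d _ _ /(_ k)].
  by rewrite normc_real ger0_norm; case/andP: xc.
by rewrite mul1r -rmorphB normc_real.
Qed.

Lemma lipschitzc_cis (b : R) k : lipschitzc (fun x => cis (b * x k)).
Proof.
exists (1 + 2 * `|b|); first by rewrite addr_ge0 // mulr_ge0.
split=> [x _|x y d _ _ xy]; first by rewrite normc_cis lerDl mulr_ge0.
apply: le_trans (normc_cisB _ _) _; rewrite -mulrBr normrM mulrA [leRHS]mulrDl mul1r.
by apply: ler_wpDl; [exact: near_by_ge0 xy | rewrite ler_wpM2l ?mulr_ge0].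
Qed.

End LipschitzFunctions.

(** * The equations as sections on the torus *)

Section ProductSections.
Variables (R : realType).
Local Notation C := (R[i]).

(* A degree one map from the torus to the projective line, lifted to C^2:
   at y = 1 it is cis (2 pi x) times its value at y = 0. The j-th torus has
   coordinates x = [odc j] and y = [evc j]. *)
Definition spinor (x y : R) (b : 'I_2) : C :=
  if b == ord0 then ((1 - y)%:C)%C + (y%:C)%C * cis (2 * pi * x)
  else (y * (1 - y))%:C%C.

Lemma cis_2pi : cis (2 * pi * 1 : R) = 1.
Proof. by rewrite mulr1 mulr_natl /cis cos2pi sin2pi. Qed.

Lemma spinor_twist (x y x0 y0 : R) (w : bool) b :
    x = x0 \/ (x = 1 /\ x0 = 0) -> (if w then y = 1 /\ y0 = 0 else y = y0) ->
  spinor x y b = cis (2 * pi * (w%:R * x0)) * spinor x0 y0 b.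
Proof.
move=> hx hy; have ex : cis (2 * pi * x) = cis (2 * pi * x0).
  by case: hx => [->//|[-> ->]]; rewrite cis_2pi mulr0 cis0.
rewrite /spinor ex; case: w hy => [[-> ->]|->]; last by rewrite mul0r mulr0 cis0 mul1r.
rewrite mul1r !(subrr, subr0, mulr0, mul0r, rmorph0, rmorph1).
by case: ifP => _; rewrite ?mul0r ?add0r ?addr0 ?mul1r ?mulr1 ?mulr0.
Qed.

(** The second component vanishes only for y = 0 or y = 1, where the first has modulus 1. *)
Lemma spinor_neq0 (x y : R) : exists b, spinor x y b != 0.
Proof.
have n0 : cis (2 * pi * x) != 0.
  by apply/eqP => h; have := normc_cis (2 * pi * x);
    rewrite h Normc.normc0 => /esym/eqP; rewrite oner_eq0.
have [e|ne] := eqVneq (y * (1 - y)) 0; last first.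
  by exists ord_max; rewrite /spinor /=; apply: contra ne => /eqP[/eqP].
exists ord0; rewrite /spinor /=; move/eqP: e; rewrite mulf_eq0 => /orP[/eqP ->|].
  by rewrite subr0 mul0r addr0 oner_eq0.
by rewrite subr_eq0 => /eqP <-; rewrite subrr add0r mul1r.
Qed.

Definition conj_if (c : bool) (z : C) : C := if c then conjc z else z.

Lemma conj_ifM c z z' : conj_if c (z * z') = conj_if c z * conj_if c z'.
Proof. by case: c => //=; rewrite rmorphM. Qed.

(** Conjugation reverses the phase: this produces the entries -1 of the sign matrix. *)
Lemma conj_if_cis c (t : R) :
  conj_if c (cis (2 * pi * t)) = cis (2 * pi * (((-1) ^+ c : int)%:~R * t)).
Proof.
case: c; last by rewrite expr0 mulr1z mul1r.
by rewrite /conj_if conjc_cis expr1 mulrN1z mulN1r mulrN.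
Qed.

Variable n : nat.
Local Notation n1 := n.+1.
Local Notation M := n.*2.+2.

Definition spinors (x : 'I_M -> R) (j : 'I_n1) : 'rV[C]_2 :=
  \row_b spinor (x (odc j)) (x (evc j)) b.

Definition equation (S : {set 'I_n1}) (e : qspace R n1) (x : 'I_M -> R) : C :=
  \sum_(s : {ffun 'I_n1 -> 'I_2})
    (\prod_j conj_if (j \in S) (spinor (x (odc j)) (x (evc j)) (s j))) * (e s)^*.

Lemma equationE S e x :
  qdot (prodvec (partial_conj S (spinors x))) e = equation S e x.
Proof.
apply: eq_bigr => s _; congr (_ * _); rewrite ffunE; apply: eq_bigr => j _.
by rewrite /partial_conj /conj_if; case: ifP => _; rewrite !mxE.
Qed.

Lemma equation_lipschitz S e : lipschitzc (equation S e).
Proof.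
apply: lipschitzc_sum => s; apply: lipschitzcM; last exact: lipschitzc_cst.
apply: lipschitzc_prod => j.
have L : lipschitzc (fun x : 'I_M -> R => spinor (x (odc j)) (x (evc j)) (s j)).
  have Ly : lipschitzc (fun x : 'I_M -> R => ((1 - x (evc j))%:C)%C).
    rewrite (_ : (fun _ => _) = fun x : 'I_M -> R => 1 + (-1) * ((x (evc j))%:C)%C).
      apply: lipschitzcD; first exact: lipschitzc_cst.
      by apply: lipschitzcM; [exact: lipschitzc_cst|exact: lipschitzc_coord].
    by apply/funext => x; rewrite rmorphB mulN1r.
  rewrite /spinor; case: (s j == ord0).
    apply: lipschitzcD => //; apply: lipschitzcM; first exact: lipschitzc_coord.
    exact: lipschitzc_cis.
  rewrite (_ : (fun _ => _) = fun x : 'I_M -> R => ((x (evc j))%:C * (1 - x (evc j))%:C)%C).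
    by apply: lipschitzcM => //; exact: lipschitzc_coord.
  by apply/funext => x; rewrite rmorphM.
by rewrite /conj_if; case: (j \in S) => //; exact: lipschitzc_conj.
Qed.

(** Both components of a spinor acquire the same phase, so all terms of the equation share one
    factor. *)
Lemma equation_twist (S : {set 'I_n1}) e (x x0 : 'I_M -> R) (w : 'I_n1 -> bool) :
    (forall j, x (odc j) = x0 (odc j) \/ (x (odc j) = 1 /\ x0 (odc j) = 0)) ->
    (forall j, if w j then x (evc j) = 1 /\ x0 (evc j) = 0 else x (evc j) = x0 (evc j)) ->
  equation S e x =
  cis (2 * pi * \sum_j (((-1) ^+ (j \in S))%:~R * ((w j)%:R * x0 (odc j)))) * equation S e x0.
Proof.
move=> hx hy; rewrite /equation mulr_sumr; apply: eq_bigr => s _.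
rewrite mulrA; congr (_ * _).
rewrite mulr_sumr cis_sum -big_split; apply: eq_bigr => j _ /=.
by rewrite (spinor_twist _ (hx j) (hy j)) conj_ifM conj_if_cis.
Qed.

Lemma prodvec_spinors_neq0 x : prodvec (spinors x) != 0.
Proof.
have [s hs] := choice (fun j : 'I_n1 => spinor_neq0 (x (odc j)) (x (evc j))).
apply/eqP => /ffunP /(_ [ffun j => s j]); rewrite !ffunE => /eqP.
apply/negP; apply/prodf_neq0 => j _; rewrite mxE ffunE.
exact: hs.
Qed.

Lemma product_solution (S : 'I_n1 -> {set 'I_n1}) (e : 'I_n1 -> qspace R n1) :
    \sum_(s : 'S_n1) \prod_i (-1) ^+ (s i \in S i) != 0 :> int ->
  exists psi, prodvec psi != 0 /\
    forall i, qdot (prodvec (partial_conj (S i) psi)) (e i) = 0.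
Proof.
move=> per.
have [K hK] := choice (fun i => let: ex_intro2 K K0 KL := equation_lipschitz (S i) (e i) in
   ex_intro (fun K : R => 0 <= K /\ forall x y d, in_cube x -> in_cube y -> near_by d x y ->
      normc (equation (S i) (e i) x - equation (S i) (e i) y) <= K * d) K (conj K0 KL.2)).
have [x _ hx] : exists2 x : 'I_M -> R, in_cube x & forall i, equation (S i) (e i) x = 0.
  (* The sum of the constants [K i] is a Lipschitz constant valid for all equations. *)
  apply: (@common_zero R n (fun i j => (-1) ^+ (j \in S i)) _ (\sum_i K i)) => //.
  - by move=> i j; rewrite normrX normrN1 expr1n.
  - move=> i x y d xc yc xy; apply: le_trans ((hK i).2 _ _ _ xc yc xy) _.
    rewrite ler_wpM2r ?(near_by_ge0 xy) // (bigD1 i) //= lerDl sumr_ge0 // => j _.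
    by case: (hK j).
  - by move=> i; exact: equation_twist.
exists (spinors x); split=> [|i]; first exact: prodvec_spinors_neq0.
by rewrite equationE.
Qed.

End ProductSections.

(** * From subspaces to a system of n equations *)

Lemma product_vector_in_subspaces (R : realType) (n : nat) (r : nat)
    (S : 'I_r -> {set 'I_n.+1}) (D : 'I_r -> {vspace qspace R n.+1}) :
    (forall a : 'I_n.+1 -> 'I_n.+1 -> bool,
      \sum_(s : 'S_n.+1) \prod_i (-1) ^+ (a i (s i)) != 0 :> int) ->
    (\sum_(i < r) \dim (qperp (D i)) <= n.+1)%N ->
  exists psi : 'I_n.+1 -> 'rV[R[i]]_2,
    prodvec psi != 0 /\ forall i : 'I_r, prodvec (partial_conj (S i) psi) \in D i.
Proof.
move=> per dimD.
pose eqs := flatten [seq [seq (S i, b) | b <- vbasis (qperp (D i))] | i <- enum 'I_r].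
have eqs_size : (size eqs <= n.+1)%N.
  rewrite size_flatten /shape -map_comp sumnE big_map big_enum /=.
  apply: leq_trans dimD; apply: leq_sum => i _.
  by rewrite /= size_map size_tuple.
(* If there are fewer equations than factors, the list is padded with the zero vector, which gives
   trivial equations. *)
pose q (l : 'I_n.+1) := nth (finset.set0, 0) eqs l.
have [psi [psi0 hpsi]] := @product_solution R n (fun l => (q l).1) (fun l => (q l).2)
  (per (fun i j => j \in (q i).1)).
exists psi; split=> // i; apply: mem_qperp_dual => e he.
have /(nthP (finset.set0, 0))[l lt el] : (S i, e) \in eqs.
  apply/flattenP; exists [seq (S i, b) | b <- vbasis (qperp (D i))].
    by apply/mapP; exists i; rewrite ?mem_enum.
  by apply/mapP; exists e.
have ln : (l < n.+1)%N by exact: leq_trans eqs_size.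
by have := hpsi (Ordinal ln); rewrite /q /= el.
Qed.

Theorem theorem3p2 (R : realType) (k : nat) (hk : (2 <= k)%N)
  (r : nat) (S : 'I_r -> {set 'I_(2 ^ k).-1})
  (D : 'I_r -> {vspace qspace R (2 ^ k).-1})
  (hdim : (\sum_(i < r) \dim (qperp (D i)) <= (2 ^ k).-1)%N) :
  exists psi : 'I_(2 ^ k).-1 -> 'rV[R[i]]_2,
    prodvec psi != 0 /\
    forall i : 'I_r, prodvec (partial_conj (S i) psi) \in D i.
Proof.
have n0 : (0 < (2 ^ k).-1)%N by have := leq_pexp2l (isT : 0 < 2)%N hk; lia.
move: n0 (@permanent_sign_neq0 k) S D hdim.
(* The torus argument is stated for a number of factors in successor form. *)
case: (2 ^ k).-1 => // n _ per S D hdim.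
exact: product_vector_in_subspaces.
Qed.
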